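(* Let $\mathcal{A}_t\subseteq\mathbb{R}^d$ be the action set and let $Z_t=\lambda I_{Kd}+V_t\Lambda_tV_t^\top$, where $\lambda>0$, $V_t\in\mathbb{R}^{Kd\times m}$ has orthonormal columns and $\Lambda_t\in\mathbb{R}^{m\times m}$ is diagonal and positive semidefinite. Then for any $x\in\mathcal{A}_t$, $$\left\|Z_t^{-\frac12}(I_K\otimes x)\right\|_2^2=\|A(x)\|_2,$$ where $A(x)\in\mathbb{R}^{K\times K}$ is the symmetric matrix with entries $$A(x)_{ij}=\sum_{k=1}^m\left(\frac1{\mu_k+\lambda}-\frac1\lambda\right)\langle x,u_{ki}\rangle\langle x,u_{kj}\rangle+\frac{\|x\|_2^2}{\lambda}\delta_{ij}.$$ Here $\mu_k$ is the $k$-th diagonal element of $\Lambda_t$, $u_{ki}\in\mathbb{R}^d$ is the sub-vector formed by the entries with indices $(i-1)d+1$ to $id$ of the $k$-th column of $V_t$, and $\delta_{ij}$ is the Kronecker delta.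
   Context: $\|\cdot\|_2$ denotes the spectral norm for matrices and the Euclidean norm for vectors; $\otimes$ is the Kronecker product, so $I_K\otimes x\in\mathbb{R}^{Kd\times K}$ for a column vector $x\in\mathbb{R}^d$. $K,d,m$ are positive integers. *)

(* Defs.v *)
From mathcomp Require Import all_boot all_order all_algebra.
From mathcomp Require Import boolp classical_sets reals.
From mathcomp Require Import mxtens.

Set Implicit Arguments.
Unset Strict Implicit.
Unset Printing Implicit Defensive.

Import Order.TTheory GRing.Theory Num.Theory.
Local Open Scope classical_set_scope.
Local Open Scope ring_scope.

Definition dotv (R : realType) (n : nat) (u v : 'cV[R]_n) : R :=
  \sum_(l < n) u l 0 * v l 0.

Definition norm2 (R : realType) (n : nat) (v : 'cV[R]_n) : R :=
  Num.sqrt (dotv v v).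

(* The operator norm induced by norm2. *)
Definition spectral_norm (R : realType) (p q : nat) (M : 'M[R]_(p, q)) : R :=
  sup [set norm2 (M *m v) | v in [set v : 'cV[R]_q | norm2 v <= 1]].

Definition psdmx (R : realType) (n : nat) (M : 'M[R]_n) : Prop :=
  M^T = M /\ forall v : 'cV[R]_n, 0 <= dotv v (M *m v).

(* The positive semidefinite square root, which exists and is unique when M is
   positive semidefinite; the value is 0 (junk) otherwise. *)
Definition sqrtmx (R : realType) (n : nat) (M : 'M[R]_n) : 'M[R]_n :=
  xget 0 [set S | psdmx S /\ S *m S = M].

(* M^{-1/2}, meaningful for positive definite M. *)
Definition invsqrtmx (R : realType) (n : nat) (M : 'M[R]_n) : 'M[R]_n :=
  invmx (sqrtmx M).

(* The Kronecker product I_K (x) x; the cast only turns K * 1 into K. *)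
Definition kronI (R : realType) (K d : nat) (x : 'cV[R]_d) : 'M[R]_(K * d, K) :=
  castmx (erefl, muln1 K) (1%:M *t x).

(* Entries i * d, ..., i * d + (d - 1) (with i, k counted from 0) of column k:
   mxtens_index (i, l) has value i * d + l. *)
Definition subcol (R : realType) (K d m : nat) (V : 'M[R]_(K * d, m))
    (k : 'I_m) (i : 'I_K) : 'cV[R]_d :=
  \col_(l < d) V (mxtens_index (i, l)) k.

Definition Amx (R : realType) (K d m : nat) (lambda : R)
    (V : 'M[R]_(K * d, m)) (Lambda : 'M[R]_m) (x : 'cV[R]_d) : 'M[R]_K :=
  \matrix_(i < K, j < K)
    (\sum_(k < m) ((Lambda k k + lambda)^-1 - lambda^-1)
                  * dotv x (subcol V k i) * dotv x (subcol V k j)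
     + norm2 x ^+ 2 / lambda * (i == j)%:R).

(* Main.v *)
(** For [M = Z^{-1/2} (I_K (x) x)] one has [M^T M = (I_K (x) x)^T Z^{-1} (I_K (x) x)],
    and [Z^{-1} = lambda^{-1} I + V diag (1/(mu_k + lambda) - 1/lambda) V^T]
    because the columns of [V] are orthonormal, so [M^T M = A(x)]. The theorem
    is then the identity [||M||^2 = ||M^T M||]. Every symmetric square root of
    [Z] gives the same [M^T M], so uniqueness of the square root plays no role. *)
Require Import Defs.
From mathcomp Require Import all_boot all_order all_algebra.
From mathcomp Require Import boolp classical_sets reals.
From mathcomp Require Import ring mxtens.

Set Implicit Arguments.
Unset Strict Implicit.
Unset Printing Implicit Defensive.

Import Order.TTheory GRing.Theory Num.Theory.
Local Open Scope ring_scope.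

(** * Euclidean inner product and norm *)

Lemma dotvE (R : realType) (n : nat) (u v : 'cV[R]_n) :
  dotv u v = (u^T *m v) 0 0.
Proof. by rewrite mxE; apply: eq_bigr => l _; rewrite mxE. Qed.

Lemma dotvC (R : realType) (n : nat) (u v : 'cV[R]_n) : dotv u v = dotv v u.
Proof. by apply: eq_bigr => l _; rewrite mulrC. Qed.

Lemma dotv_mulmxl (R : realType) (p q : nat) (M : 'M[R]_(p, q))
    (u : 'cV[R]_q) (v : 'cV[R]_p) :
  dotv (M *m u) v = dotv u (M^T *m v).
Proof. by rewrite !dotvE trmx_mul mulmxA. Qed.

Lemma dotvZ (R : realType) (n : nat) (a b : R) (u v : 'cV[R]_n) :
  dotv (a *: u) (b *: v) = a * b * dotv u v.
Proof. by rewrite /dotv mulr_sumr; apply: eq_bigr => l _; rewrite !mxE mulrACA. Qed.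

Lemma dotv_ge0 (R : realType) (n : nat) (v : 'cV[R]_n) : 0 <= dotv v v.
Proof. by apply: sumr_ge0 => l _; rewrite -expr2 sqr_ge0. Qed.

Lemma dotv_eq0 (R : realType) (n : nat) (v : 'cV[R]_n) :
  dotv v v = 0 -> v = 0.
Proof.
move=> /psumr_eq0P v0; apply/matrixP => i j; rewrite (ord1 j) mxE.
have /eqP : v i 0 * v i 0 = 0 by apply: v0 => // l _; rewrite -expr2 sqr_ge0.
by rewrite mulf_eq0 orbb => /eqP.
Qed.

Lemma norm2_ge0 (R : realType) (n : nat) (v : 'cV[R]_n) : 0 <= norm2 v.
Proof. exact: sqrtr_ge0. Qed.

Lemma sqr_norm2 (R : realType) (n : nat) (v : 'cV[R]_n) :
  norm2 v ^+ 2 = dotv v v.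
Proof. by rewrite sqr_sqrtr ?dotv_ge0. Qed.

Lemma norm2_0 (R : realType) (n : nat) : norm2 (0 : 'cV[R]_n) = 0.
Proof. by rewrite /norm2 dotvE mulmx0 mxE sqrtr0. Qed.

Lemma norm2_eq0 (R : realType) (n : nat) (v : 'cV[R]_n) :
  norm2 v = 0 -> v = 0.
Proof. by move=> v0; apply: dotv_eq0; rewrite -sqr_norm2 v0 expr0n. Qed.

Lemma norm2Z (R : realType) (n : nat) (a : R) (v : 'cV[R]_n) :
  0 <= a -> norm2 (a *: v) = a * norm2 v.
Proof.
move=> a0.
by rewrite /norm2 dotvZ -expr2 sqrtrM ?sqr_ge0// sqrtr_sqr ger0_norm.
Qed.

(** Cauchy-Schwarz: with [a = norm2 u] and [b = norm2 v], the square of the norm of [b u - a v]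
    expands to [2ab (ab - dotv u v)]. Dividing by [2ab] requires both norms to be nonzero, hence the
    two degenerate cases. *)
Lemma dotv_le_norm2 (R : realType) (n : nat) (u v : 'cV[R]_n) :
  dotv u v <= norm2 u * norm2 v.
Proof.
have [/norm2_eq0 ->|nu] := eqVneq (norm2 u) 0.
  by rewrite norm2_0 mul0r dotvE trmx0 mul0mx mxE.
have [/norm2_eq0 ->|nv] := eqVneq (norm2 v) 0.
  by rewrite norm2_0 mulr0 dotvE mulmx0 mxE.
set a := norm2 u in nu *; set b := norm2 v in nv *.
have a0 : 0 < a by rewrite lt0r nu norm2_ge0.
have b0 : 0 < b by rewrite lt0r nv norm2_ge0.
have := dotv_ge0 (b *: u - a *: v).
have -> : dotv (b *: u - a *: v) (b *: u - a *: v)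
    = (2 * a * b) * (a * b - dotv u v).
  transitivity (b * b * dotv u u - 2 * (a * b * dotv u v) + a * a * dotv v v).
    rewrite /dotv !mulr_sumr -sumrB -big_split /=.
    by apply: eq_bigr => l _; rewrite !mxE; ring.
  by rewrite -!sqr_norm2 -/a -/b; ring.
by rewrite pmulr_rge0 ?subr_ge0// !mulr_gt0.
Qed.

(** * Spectral norm as a genuine supremum, and its value on [M^T M] *)

Lemma spectral_set_has_sup (R : realType) (p q : nat) (M : 'M[R]_(p, q)) :
  has_sup [set norm2 (M *m v) | v in [set v : 'cV[R]_q | norm2 v <= 1]]%classic.
Proof.
split; first by exists (norm2 (M *m 0)), 0 => //=; rewrite norm2_0 ler01.
(* The upper bound is the Frobenius norm of [M]: by Cauchy-Schwarz each coordinate of [M v] is at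
   most the norm of the corresponding row. *)
exists (Num.sqrt (\sum_(i < p) norm2 (row i M)^T ^+ 2)) => _ [v /= v1 <-].
apply: ler_wsqrtr; apply: ler_sum => i _.
have rowE w : (M *m w) i 0 = dotv (row i M)^T w.
  by rewrite mxE; apply: eq_bigr => l _; rewrite !mxE.
rewrite -expr2 -ler_sqrt ?sqr_ge0// !sqrtr_sqr [leRHS]ger0_norm ?norm2_ge0//.
have le_row (w : 'cV[R]_q) : norm2 w <= 1 -> (M *m w) i 0 <= norm2 (row i M)^T.
  move=> w1; rewrite rowE (le_trans (dotv_le_norm2 _ _))//.
  by rewrite ler_piMr ?norm2_ge0.
(* The lower half of the absolute value bound is the upper half at [- v], which also lies in the
   unit ball. *)
rewrite ler_norml le_row// andbT lerNl.
have -> : - (M *m v) i 0 = (M *m - v) i 0 by rewrite mulmxN [RHS]mxE.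
by apply: le_row; rewrite /norm2 -scaleN1r dotvZ mulrNN !mul1r.
Qed.

Lemma spectral_norm_ge0 (R : realType) (p q : nat) (M : 'M[R]_(p, q)) :
  0 <= spectral_norm M.
Proof.
rewrite -(norm2_0 R p) -(mulmx0 _ M).
apply: ub_le_sup; first by have [] := spectral_set_has_sup M.
by exists 0 => //=; rewrite norm2_0 ler01.
Qed.

Lemma norm2_mulmx_le (R : realType) (p q : nat) (M : 'M[R]_(p, q))
    (v : 'cV[R]_q) :
  norm2 (M *m v) <= spectral_norm M * norm2 v.
Proof.
have [/norm2_eq0 ->|nv] := eqVneq (norm2 v) 0.
  by rewrite mulmx0 !norm2_0 mulr0.
have v0 : 0 < norm2 v by rewrite lt0r nv norm2_ge0.
rewrite -ler_pdivrMr// mulrC -norm2Z ?invr_ge0 ?norm2_ge0// scalemxAr.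
apply: ub_le_sup; first by have [] := spectral_set_has_sup M.
by exists ((norm2 v)^-1 *: v) => //=; rewrite norm2Z ?invr_ge0 ?norm2_ge0// mulVf.
Qed.

Lemma spectral_norm_le (R : realType) (p q : nat) (M : 'M[R]_(p, q)) (c : R) :
  (forall v, norm2 v <= 1 -> norm2 (M *m v) <= c) -> spectral_norm M <= c.
Proof.
move=> Mc; apply: ge_sup; first by have [] := spectral_set_has_sup M.
by move=> _ [v /= v1 <-]; exact: Mc.
Qed.

(** This is the half of the equality of the norms of [M] and [M^T] that is needed: the square of the
    left side is the inner product of [w] with [M M^T w], so Cauchy-Schwarz leaves one factor
    [norm2 (M^T *m w)] to cancel. *)
Lemma norm2_trmx_mulmx_le (R : realType) (p q : nat) (M : 'M[R]_(p, q))
    (w : 'cV[R]_p) :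
  norm2 (M^T *m w) <= spectral_norm M * norm2 w.
Proof.
have [->|n0] := eqVneq (norm2 (M^T *m w)) 0.
  by rewrite mulr_ge0 ?spectral_norm_ge0 ?norm2_ge0.
have Mw0 : 0 < norm2 (M^T *m w) by rewrite lt0r n0 norm2_ge0.
rewrite -(ler_pM2r Mw0) -expr2 sqr_norm2 dotv_mulmxl trmxK.
apply: (le_trans (dotv_le_norm2 _ _)).
rewrite mulrAC mulrC ler_wpM2r ?norm2_ge0//.
exact: norm2_mulmx_le.
Qed.

(** From above, the norm of [M^T M v] is bounded by applying [M] and then [M^T]. From below, the
    square of [norm2 (M *m v)] is the inner product of [v] with [M^T M v], at most the norm of
    [M^T M] on the unit ball. *)
Lemma sqr_spectral_norm (R : realType) (p q : nat) (M : 'M[R]_(p, q)) :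
  spectral_norm M ^+ 2 = spectral_norm (M^T *m M).
Proof.
apply/eqP; rewrite eq_le; apply/andP; split; last first.
  apply: spectral_norm_le => v v1; rewrite -mulmxA.
  apply: (le_trans (norm2_trmx_mulmx_le _ _)).
  rewrite expr2 ler_wpM2l ?spectral_norm_ge0//.
  apply: (le_trans (norm2_mulmx_le _ _)).
  by rewrite ler_piMr ?spectral_norm_ge0.
set c := spectral_norm (M^T *m M).
have c0 : 0 <= c := spectral_norm_ge0 _.
rewrite -[leRHS](sqr_sqrtr c0) ler_sqr ?nnegrE ?spectral_norm_ge0 ?sqrtr_ge0//.
apply: spectral_norm_le => v v1; apply: ler_wsqrtr.
rewrite dotv_mulmxl mulmxA (le_trans (dotv_le_norm2 _ _))//.
rewrite -[leRHS]mul1r ler_pM ?norm2_ge0//.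
by rewrite (le_trans (norm2_mulmx_le _ _))// ler_piMr.
Qed.

(** * Calculus of the matrices [a I + V diag(e) V^T] for [V] with orthonormal columns *)

Section ScalarPlusLowRank.
Variables (R : realType) (n m : nat) (V : 'M[R]_(n, m)).
Hypothesis hV : V^T *m V = 1%:M.

(** Column [k] of [V] is an eigenvector of the factors, with eigenvalues [a + e_k] and [b + f_k];
    the new coefficient is the product of these minus [a b]. *)
Lemma mulmx_scalar_lowrank (a b : R) (e f : 'rV[R]_m) :
  (a%:M + V *m diag_mx e *m V^T) *m (b%:M + V *m diag_mx f *m V^T)
  = (a * b)%:M
    + V *m diag_mx (\row_k (a * f 0 k + b * e 0 k + e 0 k * f 0 k)) *m V^T.
Proof.
have -> : diag_mx (\row_k (a * f 0 k + b * e 0 k + e 0 k * f 0 k))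
    = a *: diag_mx f + b *: diag_mx e + diag_mx e *m diag_mx f.
  rewrite mulmx_diag -!linearZ -!linearD /=; congr diag_mx.
  by apply/rowP => k; rewrite !mxE.
have VV : V *m diag_mx e *m V^T *m (V *m diag_mx f *m V^T)
    = V *m (diag_mx e *m diag_mx f) *m V^T.
  by rewrite -!mulmxA (mulmxA V^T) hV mul1mx.
rewrite mulmxDl !mulmxDr VV -scalar_mxM mul_scalar_mx mul_mx_scalar.
by rewrite !mulmxDl -!scalemxAr -!scalemxAl !addrA.
Qed.

Lemma psdmx_scalar_lowrank (a : R) (e : 'rV[R]_m) :
  0 <= a -> (forall k, 0 <= e 0 k) -> psdmx (a%:M + V *m diag_mx e *m V^T).
Proof.
move=> a0 e0; split.
  by rewrite linearD /= tr_scalar_mx !trmx_mul trmxK tr_diag_mx mulmxA.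
move=> v; rewrite mulmxDl dotvE mulmxDr mxE -!dotvE addr_ge0//.
  by rewrite mul_scalar_mx -[X in dotv X]scale1r dotvZ mul1r mulr_ge0 ?dotv_ge0.
(* Moving [V] across turns the form into the sum of [e_k] times the square of the [k]-th entry of
   [V^T v]. *)
rewrite -!mulmxA dotvC dotv_mulmxl dotvC.
apply: sumr_ge0 => k _; rewrite mul_diag_mx [X in _ * X]mxE mulrCA -expr2.
by rewrite mulr_ge0 ?sqr_ge0.
Qed.

Lemma invmx_scalar_lowrank (a : R) (e : 'rV[R]_m) :
  0 < a -> (forall k, 0 <= e 0 k) ->
  (a%:M + V *m diag_mx e *m V^T)
    *m (a^-1%:M + V *m diag_mx (\row_k ((e 0 k + a)^-1 - a^-1)) *m V^T) = 1%:M.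
Proof.
move=> a0 e0; rewrite mulmx_scalar_lowrank divff ?gt_eqF//.
rewrite [X in diag_mx X](_ : _ = 0) ?linear0 ?mulmx0 ?mul0mx ?addr0//.
apply/rowP => k; rewrite !mxE; field.
by rewrite !gt_eqF// ltr_wpDl.
Qed.

(** Exhibiting one root excludes the default value of [xget]. The witness takes square roots of
    eigenvalues: [e_k + a] on column [k] of [V], and [a] on the orthogonal complement. *)
Lemma sqrtmx_scalar_lowrank (a : R) (e : 'rV[R]_m) :
  let Z := a%:M + V *m diag_mx e *m V^T in
  0 <= a -> (forall k, 0 <= e 0 k) ->
  psdmx (sqrtmx Z) /\ sqrtmx Z *m sqrtmx Z = Z.
Proof.
move=> Z a0 e0.
apply: (@xgetPex _ 0 [set S | psdmx S /\ S *m S = Z]%classic).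
exists ((Num.sqrt a)%:M
        + V *m diag_mx (\row_k (Num.sqrt (e 0 k + a) - Num.sqrt a)) *m V^T).
split.
  apply: psdmx_scalar_lowrank => [|k]; first exact: sqrtr_ge0.
  by rewrite mxE subr_ge0 ler_wsqrtr// lerDr.
rewrite mulmx_scalar_lowrank -expr2 sqr_sqrtr// /Z; congr (_ + _ *m diag_mx _ *m _).
apply/rowP => k; rewrite !mxE.
have sa := sqr_sqrtr a0; have sb := sqr_sqrtr (addr_ge0 (e0 k) a0).
transitivity (Num.sqrt (e 0 k + a) ^+ 2 - Num.sqrt a ^+ 2); first by ring.
by rewrite sa sb addrK.
Qed.

End ScalarPlusLowRank.

(** * Block structure of [kronI K x] and factorization of [Amx] *)

Lemma kronIE (R : realType) (K d : nat) (x : 'cV[R]_d) (i j : 'I_K) (l : 'I_d) :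
  kronI K x (mxtens_index (i, l)) j = (i == j)%:R * x l 0.
Proof.
rewrite castmxE /= cast_ord_id.
have -> : cast_ord (esym (muln1 K)) j = mxtens_index (j, (0 : 'I_1)).
  by apply: val_inj; rewrite /= muln1 addn0.
by rewrite tensmxE mxE.
Qed.

Lemma trmx_mul_kronI (R : realType) (K d m : nat) (V : 'M[R]_(K * d, m))
    (x : 'cV[R]_d) (k : 'I_m) (i : 'I_K) :
  (V^T *m kronI K x) k i = dotv x (subcol V k i).
Proof.
(* The sum over [K * d] splits into block and offset; only block [i] survives. *)
rewrite mxE (reindex (@mxtens_index K d)) /=; last first.
  by exists (@mxtens_unindex K d) => y _; rewrite ?mxtens_indexK ?mxtens_unindexK.
pose F a b := V^T k (mxtens_index (a, b)) * kronI K x (mxtens_index (a, b)) i.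
rewrite (eq_bigr (fun p => F p.1 p.2)); last by case.
rewrite -(pair_bigA _ F) /= /F (bigD1 i)//= [X in _ + X]big1 ?addr0.
  by apply: eq_bigr => l _; rewrite kronIE eqxx !mxE mul1r mulrC.
by move=> a /negPf ai; apply: big1 => l _; rewrite kronIE ai mul0r mulr0.
Qed.

(** Allows [trmx_mul_kronI] to be used with [V := kronI K x], which yields the term of [Amx] in the
    square of [norm2 x]. *)
Lemma subcol_kronI (R : realType) (K d : nat) (x : 'cV[R]_d) (i j : 'I_K) :
  subcol (kronI K x) i j = (i == j)%:R *: x.
Proof. by apply/colP => l; rewrite mxE kronIE mxE eq_sym. Qed.

Lemma AmxE (R : realType) (K d m : nat) (lambda : R) (V : 'M[R]_(K * d, m))
    (Lambda : 'M[R]_m) (x : 'cV[R]_d) :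
  Amx lambda V Lambda x
  = (kronI K x)^T
    *m (lambda^-1%:M
        + V *m diag_mx (\row_k ((Lambda k k + lambda)^-1 - lambda^-1)) *m V^T)
    *m kronI K x.
Proof.
rewrite mulmxDr mulmxDl mul_mx_scalar -scalemxAl.
set D := diag_mx _.
have -> : (kronI K x)^T *m (V *m D *m V^T) *m kronI K x
    = (V^T *m kronI K x)^T *m (D *m (V^T *m kronI K x)).
  by rewrite trmx_mul trmxK !mulmxA.
apply/matrixP => i j; rewrite [RHS]mxE addrC mxE; congr (_ + _).
  rewrite mxE; apply: eq_bigr => k _; rewrite mul_diag_mx [_^T _ _]mxE.
  by rewrite trmx_mul_kronI [X in _ = _ * X]mxE trmx_mul_kronI mxE; ring.
rewrite [RHS]mxE trmx_mul_kronI subcol_kronI -[X in dotv X]scale1r dotvZ.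
by rewrite sqr_norm2; ring.
Qed.

Theorem lemma1 (R : realType) (K d m : nat)
    (hK : (0 < K)%N) (hd : (0 < d)%N) (hm : (0 < m)%N)
    (At : set 'cV[R]_d) (lambda : R) (hlambda : 0 < lambda)
    (V : 'M[R]_(K * d, m)) (hV : V^T *m V = 1%:M)
    (Lambda : 'M[R]_m) (hLdiag : is_diag_mx Lambda) (hLpsd : psdmx Lambda)
    (Z : 'M[R]_(K * d)) (hZ : Z = lambda%:M + V *m Lambda *m V^T)
    (x : 'cV[R]_d) (hx : At x) :
  (Amx lambda V Lambda x)^T = Amx lambda V Lambda x /\
  spectral_norm (invsqrtmx Z *m kronI K x) ^+ 2
    = spectral_norm (Amx lambda V Lambda x).
Proof.
split.
  rewrite AmxE !trmx_mul trmxK linearD /= tr_scalar_mx !trmx_mul trmxK.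
  by rewrite tr_diag_mx !mulmxA.
have [mu LE] : exists mu, Lambda = diag_mx mu by exact/diag_mxP.
have muE k : Lambda k k = mu 0 k by rewrite LE mxE eqxx.
have mu0 k : 0 <= mu 0 k.
  (* The quadratic form at the [k]-th basis vector is the diagonal entry [mu_k]. *)
  have := hLpsd.2 (delta_mx k 0).
  by rewrite dotvE trmx_delta -colE -rowE !mxE muE.
have [[Ssym _] SS] := sqrtmx_scalar_lowrank hV (ltW hlambda) mu0.
have ZZ' := invmx_scalar_lowrank hV hlambda mu0.
rewrite -LE -hZ in Ssym SS ZZ'.
have Su : sqrtmx Z \in unitmx.
  by have [] := mulmx1_unit ZZ'; rewrite -{1}SS unitmx_mul => /andP[].
have WW : invmx (sqrtmx Z) *m invmx (sqrtmx Z) = lambda^-1%:M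
    + V *m diag_mx (\row_k ((mu 0 k + lambda)^-1 - lambda^-1)) *m V^T.
  (* With [S] the root of [Z] and [Z'] the explicit inverse, [Z' = S^-1 S^-1 (S S Z')], and
     [S S Z' = Z Z' = 1]. *)
  rewrite -[RHS](mulKmx Su) -[X in _ = _ *m X](mulKmx Su).
  by rewrite [sqrtmx Z *m (_ *m _)]mulmxA SS ZZ' mulmx1.
rewrite sqr_spectral_norm AmxE; congr spectral_norm.
rewrite (eq_mx _ (fun _ k => congr1 (fun c => (c + lambda)^-1 - _) (muE k))).
rewrite -WW /invsqrtmx trmx_mul trmx_inv Ssym.
by rewrite !mulmxA.
Qed.
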